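(* Let $q$ be an odd prime power, let $t\in\mathbb{F}_q^*$, and let $f=-x+t x^q+x^{2q-1}\in\mathbb{F}_q[x]$. Then $f$ is a permutation polynomial of $\mathbb{F}_{q^2}$ if and only if $q\equiv 1\pmod 8$ and $t^2=-2$.
   Context: $\mathbb{F}_q$ denotes the finite field with $q$ elements. A polynomial $f$ over $\mathbb{F}_{q^2}$ is a permutation polynomial of $\mathbb{F}_{q^2}$ if the map $x\mapsto f(x)$ is a bijection of $\mathbb{F}_{q^2}$. *)

(* Defs.v *)
From HB Require Import structures.
From mathcomp Require Export all_boot all_order all_algebra all_field.

Set Implicit Arguments.
Unset Strict Implicit.
Unset Printing Implicit Defensive.

Import GRing.Theory.
Local Open Scope ring_scope.

Definition prime_power (q : nat) : Prop :=
  exists p k : nat, [/\ prime p, (0 < k)%N & q = (p ^ k)%N].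

(* A polynomial over F is evaluated on the extension K of F through the
   embedding iota of F in K. *)
Definition permutation_poly (F K : finFieldType) (iota : {rmorphism F -> K})
    (f : {poly F}) : Prop :=
  bijective (fun x : K => (map_poly iota f).[x]).

(* Main.v *)
(* Put z = x ^ (q - 1), a (q + 1)-th root of unity, so that z ^ q = 1 / z.  Then
   f(x) = x h(z) with h(z) = z^2 + t z - 1 = (z - a)(z - b), and for x <> 0
   f(x) ^ (q - 1) = (1 + t z - z^2) / (z h(z)) = - 1/z + 2 t / h(z).
   If f is a permutation, the sums of f(x) ^ (q - 1) and f(x) ^ (2 (q - 1)) over
   x <> 0 vanish.  Partial fractions evaluate both: the first sum is nonzero
   unless a and b are distinct and lie in F_q, and then the second one equals
   4 - 8 / (a - b)^2.  Hence (a - b)^2 = t^2 + 4 = 2, and (a - b + t) / 2 is an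
   8th root of unity of exact order 8 in F_q.
   Conversely, if t^2 = -2 and two distinct values z, u give the same quotient,
   then (z - u)^2 + v^2 = 0 with v = z + u + t (1 + z u).  As q = 1 mod 4, the
   field F_q contains i with i^2 = -1, so z - u = +- i v; but raising to the
   power q multiplies v by 1 / (z u) and z - u by - 1 / (z u), so z = u. *)

Require Import Defs.
From mathcomp Require Import all_boot all_order all_algebra all_field.
From mathcomp Require Import all_solvable zify ring.

Set Implicit Arguments.
Unset Strict Implicit.
Unset Printing Implicit Defensive.

Import GRing.Theory.
Local Open Scope ring_scope.

Lemma primitive_root8 (R : nzRingType) (w : R) :
  -1 != 1 :> R -> w ^+ 4 = -1 -> 8.-primitive_root w.
Proof.
move=> m1 w4.
have w8 : w ^+ 8 = 1 by rewrite (exprM w 4 2) w4 sqrrN expr1n.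
have [m w_prim m8] := @prim_order_exists _ 8 w isT w8.
have nm4 : ~~ (m %| 4)%N by rewrite (prim_order_dvd w_prim) w4.
suff <- : m = 8%N by [].
have := m8; rewrite -[8%N]/(2 ^ 3)%N.
by case/(@dvdn_pfactor 2 m 3 isT)=> [[|[|[|[|]]]]] // _ mE; rewrite mE in nm4 *.
Qed.

(** * Power sums and square roots in a finite field, from a generator of its unit group *)

Section FiniteField.

Variable K : finFieldType.

Lemma finField_has_prim_root : exists w : K, #|K|.-1.-primitive_root w.
Proof.
have K_gt0 : (0 < #|K|.-1)%N by rewrite -subn1 subn_gt0 finNzRing_gt1.
have rsP : all #|K|.-1.-unity_root (enum (predC1 (0 : K))).
  apply/allP=> x; rewrite mem_enum inE /= unity_rootE => x0; apply/eqP.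
  by apply: (mulfI x0); rewrite mulr1 -exprS prednK ?expf_card // ltnW ?finNzRing_gt1.
have /hasP[w _ Hw] := has_prim_root K_gt0 rsP (enum_uniq _)
  (eq_leq (etrans (esym (cardC1 (0 : K))) (cardE _))).
by exists w.
Qed.

(** Scaling the summation index by a generator [w] multiplies the sum by [w ^+ k], which differs
    from 1. *)
Lemma finField_sum_expr_eq0 k :
  ~~ (#|K|.-1 %| k)%N -> \sum_(x : K | x != 0) x ^+ k = 0.
Proof.
have [w w_prim] := finField_has_prim_root.
rewrite (prim_order_dvd w_prim) => wk1.
have w0 : w != 0.
  by rewrite (prim_root_eq0 w_prim) -lt0n -subn1 subn_gt0 finNzRing_gt1.
have wS : \sum_(x : K | x != 0) x ^+ k = w ^+ k * \sum_(x : K | x != 0) x ^+ k.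
  rewrite {1}(reindex_inj (mulfI w0)) big_distrr /=.
  by apply: eq_big => [x|x _]; rewrite ?mulf_eq0 ?(negPf w0) // exprMn.
apply/eqP; rewrite -[_ == 0](inj_eq (mulfI (_ : w ^+ k - 1 != 0))) ?subr_eq0 //.
by rewrite mulrBl mul1r -wS subrr mulr0.
Qed.

(** Write [a] as a power of a generator: the condition on [a] forces its exponent to be even. *)
Lemma finField_sqrt_exists (a : K) m :
  #|K|.-1 = m.*2 -> a ^+ m = 1 -> exists b, b ^+ 2 = a.
Proof.
move=> Km am1; have [w w_prim] := finField_has_prim_root.
have K_gt0 : (0 < #|K|.-1)%N by rewrite -subn1 subn_gt0 finNzRing_gt1.
have aK1 : a ^+ #|K|.-1 = 1 by rewrite Km -addnn exprD am1 mulr1.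
have [i ai] := prim_rootP w_prim aK1.
have /dvdnP[j ij] : (#|K|.-1 %| i * m)%N.
  by rewrite (prim_order_dvd w_prim) exprM -ai am1.
by exists (w ^+ j); rewrite -exprM ai; congr (_ ^+ _); nia.
Qed.

End FiniteField.

(** * Sums over the (q + 1)-th roots of unity, of powers and of simple and double poles *)

Section QuadraticExtension.

Variables (q : nat) (K : finFieldType).
Hypotheses (q_odd : odd q) (q_gt1 : (1 < q)%N) (oK : #|K| = (q ^ 2)%N).
Hypotheses (q_pchar : [pchar K].-nat q) (q_eq0 : q%:R = 0 :> K).

Lemma two_neq0 : 2%:R != 0 :> K.
Proof.
apply/eqP=> two0; have : q%:R != 0 :> K; last by rewrite q_eq0 eqxx.
by rewrite -(odd_double_half q) q_odd -muln2 natrD natrM two0 mulr0 addr0 oner_neq0.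
Qed.

Lemma expr_frobD (x y : K) : (x + y) ^+ q = x ^+ q + y ^+ q.
Proof. exact: exprDn_pchar. Qed.

Lemma expr_frobN (x : K) : (- x) ^+ q = - x ^+ q.
Proof. exact: exprNn_pchar. Qed.

Lemma expr_frob2 : 2%:R ^+ q = 2%:R :> K.
Proof. by rewrite mulr2n expr_frobD expr1n. Qed.

Lemma expr_unit_root (x : K) : x != 0 -> (x ^+ q.-1) ^+ q.+1 = 1.
Proof.
move=> x0; apply: (mulfI x0); rewrite mulr1 -exprM -exprS -[RHS]expf_card oK.
by congr (_ ^+ _); rewrite -mulnn; nia.
Qed.

(** If q + 1 divides k, all q^2 - 1 terms are 1, and q^2 - 1 = -1 in [K]; otherwise (q - 1) k is not
    a multiple of q^2 - 1. *)
Lemma sum_unit_root_expr k :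
  \sum_(x : K | x != 0) (x ^+ q.-1) ^+ k = - (q.+1 %| k)%N%:R.
Proof.
have K1 : #|K|.-1 = (q.-1 * q.+1)%N.
  by rewrite oK -mulnn; nia.
case: (boolP (q.+1 %| k)%N) => [/dvdnP[j ->]|nk].
  rewrite (eq_bigr (fun=> 1)) => [|x x0]; last first.
    by rewrite mulnC exprM expr_unit_root // expr1n.
  rewrite sumr_const (cardC1 (0 : K)) oK.
  by rewrite -subn1 natrB ?expn_gt0 ?(ltnW q_gt1) // natrX q_eq0 expr0n sub0r.
rewrite oppr0; under eq_bigr do rewrite -exprM.
apply: finField_sum_expr_eq0; rewrite K1 dvdn_pmul2l //; lia.
Qed.

Lemma unit_root_pole (r x : K) : r ^+ q.+1 != 1 -> x != 0 -> r - x ^+ q.-1 != 0.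
Proof.
by move=> r1 x0; apply: contraNneq r1 => /subr0_eq->; rewrite expr_unit_root.
Qed.

(* On z ^+ q.+1 = 1 the geometric sum turns the pole into a polynomial in z. *)
Lemma pole_expansion (r x : K) : r ^+ q.+1 != 1 -> x != 0 ->
  (r - x ^+ q.-1)^-1 =
  (r ^+ q.+1 - 1)^-1 * \sum_(i < q.+1) r ^+ (q - i) * (x ^+ q.-1) ^+ i.
Proof.
move=> r1 x0; have P0 := unit_root_pole r1 x0.
have := subrXX r (x ^+ q.-1) q.+1; rewrite expr_unit_root //= => E.
have r1' : r ^+ q.+1 - 1 != 0 by rewrite subr_eq0.
apply: (mulfI r1'); rewrite mulrA divff // mul1r.
by rewrite E mulrAC divff // mul1r.
Qed.

Lemma sum_pole (r : K) : r ^+ q.+1 != 1 ->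
  \sum_(x : K | x != 0) (r - x ^+ q.-1)^-1 = - (r ^+ q / (r ^+ q.+1 - 1)).
Proof.
move=> r1; under eq_bigr => x x0 do rewrite (pole_expansion r1 x0).
rewrite -big_distrr /= exchange_big /=.
under eq_bigr do rewrite -big_distrr /= sum_unit_root_expr.
(* Only i = 0 survives: no exponent from 1 to q is a multiple of q + 1. *)
rewrite big_ord_recl /= subn0 big1 => [|i _]; first by ring.
rewrite [X in X%:R](_ : _ = 0%N) ?oppr0 ?mulr0 //.
by apply/eqP; rewrite eqb0 gtnNdvd // /bump /= add1n ltnS ltn_ord.
Qed.

(* The product of two geometric sums contributes r ^ (2 q) from i = j = 0 and q
   equal terms from i + j = q + 1, which cancel in characteristic p. *)
Lemma sum_pole_sqr (r : K) : r ^+ q.+1 != 1 ->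
  \sum_(x : K | x != 0) (r - x ^+ q.-1)^-1 ^+ 2 =
  - (r ^+ q / (r ^+ q.+1 - 1)) ^+ 2.
Proof.
move=> r1.
have inner (i : 'I_q.+1) :
    \sum_(x : K | x != 0) \sum_(j < q.+1) (r ^+ (q - i) * (x ^+ q.-1) ^+ i) *
       (r ^+ (q - j) * (x ^+ q.-1) ^+ j)
    = if i == 0 :> nat then - (r ^+ q) ^+ 2 else - r ^+ q.-1.
  rewrite exchange_big /=.
  (* The only [j] for which q + 1 divides i + j; the remainder turns q + 1 into 0 when i = 0. *)
  have j0_lt : ((q.+1 - i) %% q.+1 < q.+1)%N by rewrite ltn_mod.
  have Ej (j : 'I_q.+1) : \sum_(x : K | x != 0)
      (r ^+ (q - i) * (x ^+ q.-1) ^+ i) * (r ^+ (q - j) * (x ^+ q.-1) ^+ j) =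
      - (r ^+ (q - i) * r ^+ (q - j)) * (q.+1 %| i + j)%N%:R.
    rewrite -mulrNN opprK -sum_unit_root_expr big_distrr /=.
    by apply: eq_bigr => x _; rewrite exprD; ring.
  under eq_bigr do rewrite Ej.
  have i_lt := ltn_ord i.
  rewrite (bigD1 (Ordinal j0_lt)) //= big1 ?addr0.
    case: eqP => [i0|/eqP i0].
      by rewrite i0 !subn0 modnn subn0 addn0 dvdn0 mulr1 expr2.
    rewrite modn_small; last lia.
    rewrite subnKC ?dvdnn ?mulr1 -?exprD; last lia.
    by congr (- _ ^+ _); lia.
  move=> j jneq; rewrite [(_ %| _)%N](_ : _ = false) ?mulr0 //.
  apply: contraNF jneq => /dvdnP[c ijc]; apply/eqP/val_inj => /=.
  have j_lt := ltn_ord j.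
  have [i0|i0] := posnP i.
    by rewrite i0 subn0 modnn; move: ijc; rewrite i0; case: c => //= c; nia.
  by rewrite modn_small; case: c ijc => [|[|c]]; nia.
under eq_bigr => x x0 do rewrite (pole_expansion r1 x0) exprMn.
rewrite -big_distrr /=.
under eq_bigr => x x0 do rewrite expr2 big_distrlr /=.
rewrite exchange_big /=; under eq_bigr do rewrite inner.
rewrite big_ord_recl /= sumr_const card_ord -mulr_natl q_eq0 mul0r addr0.
by rewrite exprMn mulrN mulrC.
Qed.

(** * The trinomial on [K] and its q-th power *)

Variable T : K.
Hypotheses (T_neq0 : T != 0) (T_frob : T ^+ q = T).

(** The subfield F_q of [K] is not named; [T_frob] is what places [T] in it. *)
Definition trinomial (x : K) : K := - x + T * x ^+ q + x ^+ (2 * q - 1).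

Lemma unit_root_frob (x : K) : x != 0 -> (x ^+ q.-1) ^+ q = (x ^+ q.-1)^-1.
Proof.
move=> x0; have z0 : x ^+ q.-1 != 0 by rewrite expf_neq0.
by apply: (mulfI z0); rewrite -exprS expr_unit_root // divff.
Qed.

Lemma trinomial_factor (x : K) :
  trinomial x = x * ((x ^+ q.-1) ^+ 2 + T * x ^+ q.-1 - 1).
Proof.
rewrite /trinomial (_ : 2 * q - 1 = (q.-1 * 2).+1)%N; last lia.
rewrite -[in x ^+ q](ltn_predK q_gt1) !exprS exprM; ring.
Qed.

Lemma trinomial_frob (x : K) : x != 0 ->
  trinomial x ^+ q = x * (T - x ^+ q.-1 + (x ^+ q.-1)^-1).
Proof.
move=> x0; have z0 : x ^+ q.-1 != 0 by rewrite expf_neq0.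
rewrite trinomial_factor exprMn !expr_frobD expr_frobN expr1n (exprMn _ T) T_frob.
rewrite exprAC unit_root_frob // -[in x ^+ q](ltn_predK q_gt1) exprS.
by field.
Qed.

Lemma trinomial0 : trinomial 0 = 0.
Proof. by rewrite trinomial_factor mul0r. Qed.

(** At a nonzero root both h(z) and 1 + T z - z^2 would vanish, but their sum is 2 T z. *)
Lemma trinomial_eq0 (x : K) : (trinomial x == 0) = (x == 0).
Proof.
apply/eqP/eqP => [fx0|->]; last exact: trinomial0.
apply/eqP/idPn => x0; have z0 : x ^+ q.-1 != 0 by rewrite expf_neq0.
have := trinomial_frob x0; rewrite fx0 expr0n (gtn_eqF (ltnW q_gt1)).
move=> /esym/eqP; rewrite mulf_eq0 (negPf x0) /= => /eqP B0.
move: fx0; rewrite trinomial_factor => /eqP; rewrite mulf_eq0 (negPf x0) /=.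
move=> /eqP A0; have : 2%:R * T * x ^+ q.-1 == 0.
  rewrite -[X in X == _](_ : (x ^+ q.-1) ^+ 2 + T * x ^+ q.-1 - 1 +
     x ^+ q.-1 * (T - x ^+ q.-1 + (x ^+ q.-1)^-1) = _); last by field.
  by rewrite A0 B0 mulr0 addr0.
by rewrite !mulf_eq0 (negPf two_neq0) (negPf T_neq0) (negPf z0).
Qed.

(** * Sufficiency of the condition *)

Lemma trinomial_inj : T ^+ 2 = - 2%:R -> q = 1 %[mod 4] -> injective trinomial.
Proof.
move=> T2 q4 x y fxy.
have [x0|x0] := eqVneq x 0.
  by apply/esym/eqP; rewrite x0 -trinomial_eq0 -fxy x0 trinomial0.
have y0 : y != 0 by rewrite -trinomial_eq0 -fxy trinomial_eq0.
have fx0 : trinomial x != 0 by rewrite trinomial_eq0.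
set z := x ^+ q.-1; set u := y ^+ q.-1.
have z0 : z != 0 by rewrite expf_neq0.
have u0 : u != 0 by rewrite expf_neq0.
have [i i2] : exists i : K, i ^+ 2 = -1.
  apply: (@finField_sqrt_exists K _ (q ^ 2).-1./2).
    rewrite oK; move: q_odd; rewrite -mulnn; nia.
  rewrite -signr_odd (_ : odd _ = false) //; move: q4; rewrite -mulnn; nia.
have i_frob : i ^+ q = i.
  rewrite (divn_eq q 4) q4 exprD mulnC exprM -[4%N]/(2 * 2)%N exprM i2.
  by rewrite sqrrN !expr1n mul1r expr1.
suff zu : z = u.
  move: fxy; rewrite !trinomial_factor -/z -/u -zu => /mulIf; apply.
  by move: fx0; rewrite trinomial_factor mulf_eq0 negb_or => /andP[].
have [//|zu] := eqVneq z u.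
have zq : z ^+ q = z^-1 by exact: unit_root_frob.
have uq : u ^+ q = u^-1 by exact: unit_root_frob.
(* This is f(x) f(y)^q = f(y) f(x)^q with the common factor x y removed. *)
have key : (z ^+ 2 + T * z - 1) * (T - u + u^-1) =
           (u ^+ 2 + T * u - 1) * (T - z + z^-1).
  apply: (mulfI (mulf_neq0 x0 y0)).
  transitivity (trinomial x * trinomial y ^+ q).
    by rewrite trinomial_factor trinomial_frob // -/z -/u; ring.
  rewrite fxy -{2}fxy trinomial_factor trinomial_frob // -/z -/u; ring.
pose v := z + u + T * (1 + z * u).
have quad : (z - u) ^+ 2 + v ^+ 2 = 0.
  (* [E] is the cofactor of [u - z] in [z * u] times the difference of the two sides of [key];
     modulo T^2 = -2, the goal is 2 E = 0. *)
  pose E := (z + u) ^+ 2 + T * (1 + z * u) * (z + u) - (1 + z * u) ^+ 2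
            + T ^+ 2 * (z * u).
  have E0 : E = 0.
    have uz : u - z != 0 by rewrite subr_eq0 eq_sym.
    apply: (mulfI uz); rewrite mulr0 -[RHS](mulr0 (z * u)).
    rewrite -(subrr ((u ^+ 2 + T * u - 1) * (T - z + z^-1))) -{2}key /E.
    by field; rewrite z0 u0.
  rewrite -[RHS](mulr0 2%:R) -E0 -[LHS]subr0.
  rewrite -(mul0r ((1 + z * u) ^+ 2 - 2%:R * (z * u))).
  by rewrite -(subrr (T ^+ 2)) {2}T2 /E /v; ring.
have v_frob : v ^+ q = v / (z * u).
  rewrite /v !(expr_frobD, exprMn) expr1n T_frob zq uq.
  by field; rewrite z0 u0.
have : (z - u - i * v) * (z - u + i * v) == 0.
  by rewrite -subr_sqr exprMn i2 mulN1r opprK quad.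
have conj (j : K) : j ^+ q = j -> z - u + j * v = 0 -> z = u.
  move=> jq E; apply/eqP; rewrite -subr_eq0.
  have : (z - u + j * v) ^+ q = 0 by rewrite E expr0n (gtn_eqF (ltnW q_gt1)).
  rewrite !expr_frobD expr_frobN exprMn jq v_frob zq uq => E'.
  rewrite -(inj_eq (mulfI two_neq0)) mulr0; apply/eqP.
  (* The [j * v] terms cancel and 2 (z - u) remains. *)
  transitivity (z - u + j * v - z * u * (z^-1 - u^-1 + j * (v / (z * u)))).
    by field; rewrite z0 u0.
  by rewrite E E' mulr0 subr0.
rewrite mulf_eq0 => /orP[]/eqP; last exact: conj.
by rewrite -mulNr; apply: conj; rewrite expr_frobN i_frob.
Qed.

(** * Necessity of the condition, through power sums *)

Lemma trinomial_exprE (a b x : K) : a + b = - T -> a * b = -1 -> x != 0 ->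
  [/\ a - x ^+ q.-1 != 0, b - x ^+ q.-1 != 0 &
   trinomial x ^+ q.-1 = - (x ^+ q.-1)^-1 +
     2%:R * T * ((a - x ^+ q.-1)^-1 * (b - x ^+ q.-1)^-1)].
Proof.
move=> abD abM x0; set z := x ^+ q.-1.
have z0 : z != 0 by rewrite expf_neq0.
have hE : (a - z) * (b - z) = z ^+ 2 + T * z - 1.
  by rewrite -[T]opprK -abD -abM; ring.
have fx0 : trinomial x != 0 by rewrite trinomial_eq0.
have h0 : (a - z) * (b - z) != 0.
  by move: fx0; rewrite hE trinomial_factor mulf_eq0 negb_or => /andP[].
have /andP[az bz] : (a - z != 0) && (b - z != 0) by rewrite -negb_or -mulf_eq0.
split=> //; apply: (mulfI fx0).
rewrite -exprS (ltn_predK q_gt1) trinomial_frob // trinomial_factor -/z -hE.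
(* The numerator 1 + T z - z^2 equals 2 T z - h(z). *)
transitivity (x * (2%:R * T - (z ^+ 2 + T * z - 1) / z)).
  by field.
by rewrite -hE; field; rewrite z0 az bz.
Qed.

Lemma sum_trinomial_expr k : injective trinomial -> ~~ (q.+1 %| k)%N ->
  \sum_(x : K | x != 0) (trinomial x ^+ q.-1) ^+ k = 0.
Proof.
move=> f_inj nk; have := sum_unit_root_expr k.
rewrite (negPf nk) oppr0 (reindex_inj f_inj) /=; apply: etrans.
by apply: eq_bigl => x; rewrite trinomial_eq0.
Qed.

(** Inversion of z is the q-th power, and q is coprime to q + 1. *)
Lemma sum_unit_root_inv k : ~~ (q.+1 %| k)%N ->
  \sum_(x : K | x != 0) ((x ^+ q.-1)^-1) ^+ k = 0.
Proof.
move=> nk; transitivity (\sum_(x : K | x != 0) (x ^+ q.-1) ^+ (q * k)).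
  by apply: eq_bigr => x x0; rewrite exprM unit_root_frob.
rewrite sum_unit_root_expr Gauss_dvdr ?(negPf nk) ?oppr0 //.
exact: coprimeSn.
Qed.

Lemma sum_pole_pair_eq0 (a b : K) : a + b = - T -> a * b = -1 ->
  injective trinomial ->
  \sum_(x : K | x != 0) (a - x ^+ q.-1)^-1 * (b - x ^+ q.-1)^-1 = 0.
Proof.
move=> abD abM f_inj.
have n1 : ~~ (q.+1 %| 1)%N by rewrite dvdn1; lia.
have := sum_trinomial_expr f_inj n1.
under eq_bigr => x x0 do rewrite expr1 (let: And3 _ _ E :=
  trinomial_exprE abD abM x0 in E).
rewrite big_split /= sumrN -[X in - X + _](eq_bigr _ (fun _ _ => expr1 _)).
rewrite sum_unit_root_inv // oppr0 add0r -big_distrr /= => /eqP.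
by rewrite !mulf_eq0 (negPf two_neq0) (negPf T_neq0) /= => /eqP.
Qed.

(** A nonzero element of F_q has (q - 1)-th power 1, and (q^2 - 1) / 2 is a multiple of q - 1. *)
Lemma discriminant_sqrt : exists d : K, d ^+ 2 = T ^+ 2 + 4%:R.
Proof.
have [->|D0] := eqVneq (T ^+ 2 + 4%:R) 0; first by exists 0; rewrite expr0n.
apply: (@finField_sqrt_exists K _ (q.-1 * q.+1./2)%N).
  have qK : q.+1./2.*2 = q.+1 by move: q_odd; lia.
  by rewrite doubleMr qK oK -mulnn; nia.
rewrite exprM (_ : _ ^+ q.-1 = 1) ?expr1n //; apply: (mulfI D0).
rewrite -exprS (ltn_predK q_gt1) mulr1 expr_frobD exprAC T_frob.
by rewrite -[4%N]/(2 * 2)%N natrM exprMn expr_frob2.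
Qed.

(** Since d^2 lies in F_q, d^q is d or -d. The vanishing pole sum excludes d = 0 and conjugate
    roots. *)
Lemma trinomial_inj_roots : injective trinomial ->
  exists a b : K, [/\ a + b = - T, a * b = -1, a != b, a ^+ q = a & b ^+ q = b].
Proof.
move=> f_inj; have [d d2] := discriminant_sqrt; have n2 := two_neq0.
have four : 4%:R = 2%:R * 2%:R :> K by rewrite -natrM.
have n4 : 4%:R != 0 :> K by rewrite four mulf_neq0.
pose a := (d - T) / 2%:R; pose b := (- d - T) / 2%:R.
have abD : a + b = - T by rewrite /a /b; field.
have abM : a * b = -1.
  transitivity ((T ^+ 2 - d ^+ 2) / (2%:R * 2%:R)).
    by rewrite /a /b; field; rewrite n4 n2.
  by rewrite d2 -four; field.
have m1 : -1 != 1 :> K by rewrite eq_sym -subr_eq0 opprK -[1 + 1]/(2%:R).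
have S := sum_pole_pair_eq0 abD abM f_inj.
have dq2 : (d ^+ q) ^+ 2 = d ^+ 2.
  rewrite exprAC d2 expr_frobD exprAC T_frob four exprMn.
  by rewrite expr_frob2.
have aq : a ^+ q = (d ^+ q - T) / 2%:R.
  by rewrite /a exprMn exprVn expr_frob2 expr_frobD expr_frobN T_frob.
have bq : b ^+ q = (- d ^+ q - T) / 2%:R.
  by rewrite /b exprMn exprVn expr_frob2 expr_frobD !expr_frobN T_frob.
have [d0|d0] := eqVneq d 0.
  have a0 : a != 0.
    by rewrite /a d0 sub0r mulf_neq0 ?oppr_eq0 ?invr_eq0.
  have ba : b = a by rewrite /a /b d0 oppr0.
  have aqa : a ^+ q = a by rewrite aq d0 expr0n (gtn_eqF (ltnW q_gt1)) /a d0.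
  have a1 : a ^+ q.+1 = -1 by rewrite exprS aqa -{2}ba.
  move: S; rewrite ba; under eq_bigr do rewrite -expr2.
  rewrite sum_pole_sqr a1 // aqa => /eqP; rewrite oppr_eq0 sqrf_eq0 mulf_eq0.
  by rewrite (negPf a0) invr_eq0 subr_eq0 (negPf m1).
have ab : a != b.
  have abd : a - b = d by rewrite /a /b; field.
  by rewrite -subr_eq0 abd.
exists a, b; move/eqP: dq2; rewrite eqf_sqr => /orP[]/eqP dq.
  by split=> //; rewrite ?aq ?bq dq.
(* Conjugate roots have norm a b = -1, which makes the pole sum 1/2 instead of 0. *)
have {}aq : a ^+ q = b by rewrite aq dq.
have {}bq : b ^+ q = a by rewrite bq dq opprK.
have a1 : a ^+ q.+1 = -1 by rewrite exprS aq.
have b1 : b ^+ q.+1 = -1 by rewrite exprS bq mulrC.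
have ba0 : b - a != 0 by rewrite subr_eq0 eq_sym.
move: S.
under eq_bigr => x x0.
  have [az bz _] := trinomial_exprE abD abM x0.
  rewrite (_ : _ * _ = (b - a)^-1 * ((a - x ^+ q.-1)^-1 - (b - x ^+ q.-1)^-1)).
    over.
  by field; rewrite az bz ba0.
rewrite -big_distrr /= sumrB !sum_pole ?a1 ?b1 // aq bq => /eqP.
rewrite (_ : _ * _ = 2%:R^-1) ?invr_eq0 ?(negPf n2) //.
have -> : -1 - 1 = - 2%:R :> K by ring.
by rewrite invrN !mulrN !opprK; field; rewrite n2 ba0.
Qed.

Lemma trinomial_inj_necessary :
  injective trinomial -> T ^+ 2 = - 2%:R /\ q = 1 %[mod 8].
Proof.
move=> f_inj; have n2 := two_neq0.
have [a [b [abD abM ab aq bq]]] := trinomial_inj_roots f_inj.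
have ba0 : b - a != 0 by rewrite subr_eq0 eq_sym.
have /andP[a0 b0] : (a != 0) && (b != 0).
  by rewrite -negb_or -mulf_eq0 abM oppr_eq0 oner_neq0.
(* As -1 = a b, this is a^2 + a b. Both roots then give the same pole sum 1/T, and -1/T^2 for
   squares. *)
have a1 : a ^+ q.+1 - 1 = - T * a by rewrite exprS aq -abM -abD; ring.
have b1 : b ^+ q.+1 - 1 = - T * b by rewrite exprS bq -abM -abD; ring.
have a1' : a ^+ q.+1 != 1 by rewrite -subr_eq0 a1 mulf_neq0 ?oppr_eq0.
have b1' : b ^+ q.+1 != 1 by rewrite -subr_eq0 b1 mulf_neq0 ?oppr_eq0.
have ndvd2 : ~~ (q.+1 %| 2)%N by rewrite gtnNdvd.
have ndvd1 : ~~ (q.+1 %| 1)%N by rewrite gtnNdvd // ltnS ltnW.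
have := sum_trinomial_expr f_inj ndvd2.
under eq_bigr => x x0.
  have [az bz ->] := trinomial_exprE abD abM x0.
  have z0 : x ^+ q.-1 != 0 by rewrite expf_neq0.
  (* Partial fractions in z of (- 1/z + 2 T / h(z))^2. *)
  rewrite (_ : _ ^+ 2 = (x ^+ q.-1)^-1 ^+ 2
    + (- (4%:R * T / (a * b))) * (x ^+ q.-1)^-1 ^+ 1
    + (- (4%:R * T / (a * (b - a)) + 8%:R * T ^+ 2 / (b - a) ^+ 3))
        * (a - x ^+ q.-1)^-1
    + (4%:R * T / (b * (b - a)) + 8%:R * T ^+ 2 / (b - a) ^+ 3)
        * (b - x ^+ q.-1)^-1
    + (4%:R * T ^+ 2 / (b - a) ^+ 2) * (a - x ^+ q.-1)^-1 ^+ 2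
    + (4%:R * T ^+ 2 / (b - a) ^+ 2) * (b - x ^+ q.-1)^-1 ^+ 2).
    over.
  by field; rewrite z0 a0 b0 az bz ba0.
rewrite !big_split -!big_distrr /= !sum_unit_root_inv // !sum_pole //.
rewrite !sum_pole_sqr // a1 b1 aq bq.
set S := (X in X = 0 -> _).
have -> : S = - (4%:R / (a * b)) - 8%:R / (b - a) ^+ 2.
  by rewrite /S !mulNr !invrN !mulrN; field; rewrite a0 b0 T_neq0 ba0.
rewrite abM; set d := b - a => Sd.
have d2E : d ^+ 2 = T ^+ 2 + 4%:R.
  transitivity ((a + b) ^+ 2 - 4%:R * (a * b)); first by rewrite /d; ring.
  by rewrite abD abM; ring.
have n4 : 4%:R != 0 :> K by rewrite -[4%N]/(2 * 2)%N natrM mulf_neq0.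
have d2 : d ^+ 2 = 2%:R.
  apply/eqP; rewrite -subr_eq0 -(inj_eq (mulfI n4)) mulr0.
  rewrite (_ : _ * _ = d ^+ 2 * (- (4%:R / -1) - 8%:R / d ^+ 2)).
    by rewrite Sd mulr0.
  by rewrite invrN1 mulrN1 opprK; field.
have T2 : T ^+ 2 = - 2%:R.
  by rewrite -[LHS](addrK 4%:R) -d2E d2; ring.
split=> //.
(* Here d = b - a and T = - (a + b), so [w] is the negated root [- a]. From d^2 + T^2 = 0 follows
   w^2 = d T / 2, hence w^4 = -1. *)
pose w := (d + T) / 2%:R.
have wq : w ^+ q = w.
  rewrite /w exprMn exprVn expr_frob2 expr_frobD T_frob.
  by rewrite /d expr_frobD expr_frobN aq bq.
have w4 : w ^+ 4 = -1.
  have w2 : w ^+ 2 = d * T / 2%:R.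
    transitivity ((d ^+ 2 + T ^+ 2 + 2%:R * (d * T)) / 4%:R).
      by rewrite /w; field; rewrite ?n4 ?n2.
    by rewrite d2 T2 subrr add0r; field; rewrite ?n4 ?n2.
  rewrite -[4%N]/(2 * 2)%N exprM w2 expr_div_n exprMn d2 T2.
  by field.
have w0 : w != 0.
  by apply: contra_eq_neq w4 => ->; rewrite expr0n eq_sym oppr_eq0 oner_neq0.
have wq1 : w ^+ q.-1 = 1.
  by apply: (mulfI w0); rewrite -exprS (ltn_predK q_gt1) mulr1.
have m1 : -1 != 1 :> K by rewrite eq_sym -subr_eq0 opprK -[1 + 1]/(2%:R).
have w8 := primitive_root8 m1 w4.
move/eqP: wq1; rewrite -(prim_order_dvd w8).
by case/dvdnP=> m qm; rewrite -(ltn_predK q_gt1) qm -addn1 modnMDl.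
Qed.

End QuadraticExtension.

(** * Transfer to polynomials over F_q through the embedding *)

Theorem theorem1p1 (q : nat) (F K : finFieldType) (iota : {rmorphism F -> K})
    (t : F) :
  prime_power q -> odd q -> #|F| = q -> #|K| = (q ^ 2)%N -> t != 0 ->
  permutation_poly iota (- 'X + t *: 'X^q + 'X^(2 * q - 1)) <->
  (q = 1 %[mod 8] /\ t ^+ 2 = - 2%:R).
Proof.
move=> [p [k [p_prime k_gt0 qE]]] q_odd oF oK t0.
have pK : p \in [pchar K].
  by apply: (@card_finPcharP _ p (k * 2)%N); rewrite // oK qE expnM.
have q_gt1 : (1 < q)%N.
  by rewrite qE -(exp1n k) ltn_exp2r ?prime_gt1.
have q_pchar : [pchar K].-nat q.
  by rewrite qE pnatX (eq_pnat _ (pcharf_eq pK)) pnat_id // orbT.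
have q_eq0 : q%:R = 0 :> K.
  by rewrite qE natrX (pcharf0 pK) expr0n gtn_eqF.
have T0 : iota t != 0 by rewrite fmorph_eq0.
have Tq : iota t ^+ q = iota t by rewrite -rmorphXn -oF expf_card.
have fE x : (map_poly iota (- 'X + t *: 'X^q + 'X^(2 * q - 1))).[x] =
    trinomial q (iota t) x.
  by rewrite !rmorphD rmorphN /= linearZ /= !map_polyXn map_polyX !hornerE.
have t2E : (t ^+ 2 = - 2%:R) <-> (iota t ^+ 2 = - 2%:R).
  rewrite -rmorphXn -(rmorph_nat iota) -rmorphN.
  by split=> [->|/fmorph_inj].
split=> [/bij_inj f_inj|[q8 t2]].
  have f_inj' : injective (trinomial q (iota t)).
    by move=> x y; rewrite -!fE; apply: f_inj.
  by have [/t2E] :=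
    trinomial_inj_necessary q_odd q_gt1 oK q_pchar q_eq0 T0 Tq f_inj'.
apply: injF_bij => x y; rewrite !fE.
apply: (trinomial_inj q_odd q_gt1 oK q_pchar q_eq0 T0 Tq); first exact/t2E.
by move: q8; lia.
Qed.
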